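(* Let $q$ be a prime power, let $T=\{n_1,n_2,\dots,n_k\}$ be a set of positive integers with $k\ge 1$ and $n_1<n_2<\dots<n_k$, and let $n\ge 2n_k$ be an integer. If some element of $T$ divides $\gcd(n,2n_k)$, then there exists a $T$-partition of $V_n(q)$.
   Context: $V_n(q)$ denotes the $n$-dimensional vector space over the finite field $\mathbb{F}_q$ with $q$ elements. A partition of $V_n(q)$ is a (finite) set $\mathbf{P}=\{V_1,\dots,V_r\}$ of non-zero subspaces (called components) of $V_n(q)$ such that $\bigcup_{i=1}^r V_i=V_n(q)$ and $V_i\cap V_j=\{0\}$ for $i\neq j$. For a set $T$ of positive integers, a $T$-partition is a partition $\mathbf{P}$ such that $\{\dim V' : V'\in\mathbf{P}\}=T$ (every component has dimension in $T$, and every element of $T$ is the dimension of some component). *)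

(* Defs.v *)
From HB Require Import structures.
From mathcomp Require Import all_boot all_order all_algebra finmap.

Set Implicit Arguments.
Unset Strict Implicit.
Unset Printing Implicit Defensive.

Local Open Scope fset_scope.

Definition prime_power (q : nat) : Prop :=
  exists p e : nat, [/\ prime p, 0 < e & q = p ^ e].

Section Partitions.

Variables (F : fieldType) (V : vectType F).
Implicit Types (P : {fset {vspace V}}) (T : {fset nat}).

Definition vs_partition P : Prop :=
  [/\ forall U, U \in P -> U != 0%VS,
      forall v : V, exists2 U, U \in P & v \in U
    & forall U W, U \in P -> W \in P -> U != W -> (U :&: W = 0)%VS].

Definition T_partition T P : Prop :=
  vs_partition P /\ T = [fset \dim U | U in P].

End Partitions.

(* Main.v *)
Require Import Defs.
From HB Require Import structures.
From mathcomp Require Import all_boot all_order all_algebra all_field finmap.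
Import GRing.Theory.

(** Write N for the largest dimension n_k.  Two facts give the theorem.

    Every T is realised in dimension 2N.  Take K to be the field extension of
    F of degree N, with Frobenius map phi, and work in K * K.  The K-lines
    z |-> (z u, z w) form a partition into spaces of dimension N.  The line of
    slope phi x / x consists of the vectors (a x, a (phi x)), and the pair
    (a, x) is determined by the vector up to replacing it by (a / k, k x) with
    k in F, because F is the fixed field of phi.  So the union of the lines
    with slope of the form phi x / x is a copy of the rectangle P(K) x P(K) of
    points (a, x) of a product of projective spaces.  Fixing a and letting x
    run through an F-subspace of K gives an F-subspace of K * K (a piece of a
    row); so does fixing x and letting a run through an F-subspace (a piece of
    a column).  It remains to tile the rectangle with such pieces so that every
    size t in T occurs.  Fix a complete flag of K, and let the level of a vector
    be the dimension of the first member of the flag that contains it.  The row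
    of a is used as far as level r(a), the greatest element of T below the level
    of a (or the least element of T, if there is none).  What is left of the
    column of x is either nothing or the part of level at most c(x), the least
    element of T that is at least the level of x: this is
    [row_size_lt_col_size].  All of this is [partitionable_double].

    A realisation in dimension m >= d, with d in T, extends to dimension m + d:
    by [partitionable_add], the complement of a subspace of dimension m splits
    into spaces of dimension d.  As d divides both n and 2N, repeating this step
    leads from 2N to n.

    Each partition is handled through the map that sends a nonzero vector to its
    component; see [block_map]. *)

Set Implicit Arguments.
Unset Strict Implicit.
Unset Printing Implicit Defensive.

Local Open Scope fset_scope.

(** * Sizes of the tiles *)

Section TileSizes.
Variables (T : pred nat) (t1 N : nat).
Hypotheses (Tt1 : T t1) (TN : T N) (t1_min : forall t, T t -> t1 <= t).

Lemma prev_size a :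
  {r | T r & [/\ forall t, T t -> t < a -> t <= r & t1 < r -> r < a]}.
Proof.
have [lt_t1a|le_at1] := ltnP t1 a; last first.
  exists t1 => //; split=> [t _ lt_ta|]; last by rewrite ltnn.
  exact: ltnW (leq_trans lt_ta le_at1).
have exP: exists t, T t && (t < a) by exists t1; rewrite Tt1.
have ubP t: T t && (t < a) -> t <= a by case/andP=> _ /ltnW.
case: (ex_maxnP exP ubP) => r /andP[Tr lt_ra] r_max.
by exists r => //; split=> // t Tt lt_ta; apply: r_max; rewrite Tt.
Qed.

Lemma next_size l :
  {c | T c & l <= N -> l <= c /\ forall t, T t -> l <= t -> c <= t}.
Proof.
have [le_lN|_] := leqP l N; last by exists N.
have exP: exists t, T t && (l <= t) by exists N; rewrite TN.
case: (ex_minnP exP) => c /andP[Tc le_lc] c_min.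
by exists c => // _; split=> // t Tt le_lt; apply: c_min; rewrite Tt.
Qed.

Definition row_size a := s2val (prev_size a).
Definition col_size l := s2val (next_size l).

Lemma row_size_in a : T (row_size a).
Proof. exact: s2valP (prev_size a). Qed.

Lemma col_size_in l : T (col_size l).
Proof. exact: s2valP (next_size l). Qed.

Lemma row_sizeS t : T t -> row_size t.+1 = t.
Proof.
move=> Tt; have [r_max r_lt] := s2valP' (prev_size t.+1).
apply/eqP; rewrite eqn_leq r_max // andbT.
have [/r_lt//|le_r] := ltnP t1 (row_size t.+1).
exact: leq_trans le_r (t1_min Tt).
Qed.

(** The combinatorial heart of the tiling: a point of the rectangle, with
    coordinates of levels a and l, lies outside its row tile exactly when it
    lies in its column tile.  Both sides say that no element of T lies in the
    interval from l to a - 1: indeed c(l) is the least element of T from l on,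
    and r(a) is the greatest one below a or, if there is none, t1 < l. *)
Lemma row_size_lt_col_size a l :
  l <= N -> t1 < l -> (row_size a < l) = (a <= col_size l).
Proof.
move=> le_lN lt_t1l; have [le_lc c_min] := s2valP' (next_size l) le_lN.
have [r_max r_lt] := s2valP' (prev_size a).
rewrite -/(row_size a) -/(col_size l) in le_lc c_min r_max r_lt *.
apply/idP/idP=> [lt_rl|le_ac].
  rewrite leqNgt; apply/negP=> /(r_max _ (col_size_in l)).
  by rewrite leqNgt (leq_trans lt_rl).
rewrite ltnNge; apply/negP=> le_lr.
have /r_lt := leq_trans lt_t1l le_lr.
by rewrite ltnNge (leq_trans le_ac) // c_min // row_size_in.
Qed.

End TileSizes.

(** * Extensions of a finite field *)

Section Frobenius.
Local Open Scope ring_scope.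

(** The extension of degree N is the splitting field L of X^m - X, m = #|F| ^ N.
    The roots form a subfield, namely the fixed field of the N-th power of the
    Frobenius map, so they exhaust L; they are distinct, so L has m elements. *)
Lemma cyclic_extension (F : finFieldType) (N : nat) : (0 < N)%N ->
  exists (L : fieldExtType F) (phi : 'AEnd(L)),
    \dim {:L} = N /\ forall x, phi x = x -> x \in 1%VS.
Proof.
move=> N_gt0; set q := #|F|; pose m := (q ^ N)%N.
have q_gt1: (1 < q)%N by apply: finNzRing_gt1.
have m_gt1: (1 < m)%N by rewrite (ltn_exp2l 0).
have m1_gt0: (0 < m.-1)%N by rewrite -ltnS prednK // ltnW.
pose p (R : nzRingType) : {poly R} := 'X^m - 'X.
have Dp R: p R = ('X^(m.-1) - 1) * ('X - 0).
  by rewrite subr0 mulrBl mul1r -exprSr prednK // ltnW.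
have /FinSplittingFieldFor[/= L]: p F != 0.
  by rewrite Dp monic_neq0 ?rpredM ?monicXsubC ?monicXnsubC.
rewrite rmorphB /= map_polyXn map_polyX -/(p L) => -[zs DpL defL].
have [a _ Da] := finField_galois_generator (sub1v {:L}%AS).
have {}Da x: a x = x ^+ q by rewrite Da ?memvf // dimv1 expn1.
exists L, (a : 'AEnd(L)); split=> [|x ax]; last first.
  by rewrite Fermat's_little_theorem dimv1 expn1 -Da; apply/eqP.
have in_zs: zs =i fixedSpace (a ^+ N)%g.
  move=> z; rewrite -root_prod_XsubC -(eqp_root DpL) (sameP fixedSpaceP eqP).
  rewrite /root !hornerE subr_eq0 /= /m; congr (_ == z).
  elim: (N) => [|i IHi]; first by rewrite gal_id.
  by rewrite expgSr expnSr exprM IHi galM ?Da ?memvf.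
have zsT z: z \in zs.
  suffices defE: fixedSpace (a ^+ N)%g = {:L}%VS by rewrite in_zs defE memvf.
  apply/eqP; rewrite eqEsubv subvf -defL -[X in (_ <= X)%VS]subfield_closed.
  by rewrite agenvS // subv_add sub1v; apply/span_subvP=> y; rewrite in_zs.
have Uzs: uniq zs.
  have m0: m%:R = 0 :> L.
    have [r r_pr pcharF] := finPcharP F.
    have Dq: q = (r ^ logn r q)%N := card_pprimeChar pcharF.
    have r_q: (r %| q)%N.
      by move: q_gt1; rewrite Dq; case: (logn r q) => // k _; apply: dvdn_exp.
    have pcharL: r \in [pchar L] by rewrite pchar_lalg.
    by apply/eqP; rewrite -(dvdn_pcharf pcharL) dvdn_exp.
  rewrite -separable_prod_XsubC -(eqp_separable DpL) Dp separable_root andbC.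
  rewrite /root !hornerE subr_eq0 eq_sym expr0n gtn_eqF ?oner_eq0 //=.
  rewrite cyclotomic.separable_Xn_sub_1 // -subn1 natrB ?(ltnW m_gt1) // m0 sub0r.
  by rewrite oppr_eq0 oner_eq0.
apply: (@expnI q) => //; rewrite -/m.
have <-: #|finvect_type L| = (q ^ \dim {:L})%N.
  exact: etrans (esym (card_vspacef _)) (card_vspace _).
have/eq_card->: finvect_type L =i zs by move=> z; rewrite zsT.
apply: succn_inj; rewrite (card_uniqP _) //= -(size_prod_XsubC _ id).
by rewrite -(eqp_size DpL) size_polyDl size_polyXn // size_polyN size_polyX.
Qed.
End Frobenius.

(** * Partitions as maps from vectors to components *)

Section BlockMaps.
Import VectorInternalTheory.
Local Open Scope ring_scope.
Variable F : fieldType.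

(** A partition is recorded by the map that sends each nonzero vector to the
    component containing it.  The condition below then expresses covering and
    trivial intersection at once, and no finite set of subspaces has to be
    assembled until the end. *)
Definition block_map (V : vectType F) (f : V -> {vspace V}) : Prop :=
  forall v, v != 0 -> v \in f v /\ forall w, w != 0 -> w \in f v -> f w = f v.

Definition partitionable (V : vectType F) (T : pred nat) : Prop :=
  exists2 f : V -> {vspace V}, block_map f &
    forall t, T t <-> exists2 v, v != 0 & \dim (f v) = t.

Lemma dim_inj_img (V W : vectType F) (g : 'Hom(V, W)) (U : {vspace V}) :
  (forall v, g v = 0 -> v = 0) -> \dim (g @: U) = \dim U.
Proof.
move=> g_inj; apply: limg_dim_eq; apply/eqP; rewrite -subv0; apply/subvP=> v.
by rewrite memv_cap memv_ker memv0 => /andP[_ /eqP/g_inj->].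
Qed.

Definition lfun_pair (V A B : vectType F) (g : 'Hom(V, A)) (h : 'Hom(V, B)) :
    'Hom(V, (A * B)%type) :=
  linfun (fun v => (g v, h v)).

Lemma lfun_pairE (V A B : vectType F) (g : 'Hom(V, A)) (h : 'Hom(V, B)) v :
  lfun_pair g h v = (g v, h v).
Proof.
have gh_lin: linear (fun v => (g v, h v)) by move=> a x y; rewrite !linearP.
pose ghM := GRing.isLinear.Build F V (A * B)%type _ _ gh_lin.
pose ghL : {linear _ -> _} := HB.pack (fun v => (g v, h v)) ghM.
exact: (lfunE ghL).
Qed.

Lemma dim_pair (A B : vectType F) :
  \dim {: (A * B)%type} = (\dim {:A} + \dim {:B})%N.
Proof. by rewrite !dimvf. Qed.

Lemma dim_rV n : \dim {: 'rV[F]_n} = n.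
Proof. by rewrite dimvf dim_matrix mul1r. Qed.

Definition flag (V : vectType F) j : {vspace V} :=
  << take j (vbasis {:V}) >>%VS.

Lemma dim_flag (V : vectType F) j :
  (j <= \dim {:V})%N -> \dim (flag V j) = j.
Proof.
move=> le_jN; have /eqnP-> : free (take j (vbasis {:V})).
  apply: (@catl_free _ _ (drop j (vbasis {:V}))).
  by rewrite cat_take_drop (basis_free (vbasisP _)).
by rewrite size_takel // size_tuple.
Qed.

Lemma flagS (V : vectType F) i j : (i <= j)%N -> (flag V i <= flag V j)%VS.
Proof.
move=> le_ij; rewrite /flag -(minn_idPl le_ij) take_min.
by apply: sub_span => x /mem_take.
Qed.

Lemma flagT (V : vectType F) : flag V (\dim {:V}) = fullv.
Proof.
by rewrite /flag take_oversize ?(span_basis (vbasisP _)) // size_tuple.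
Qed.

Lemma linear_iso (V W : vectType F) : \dim {:V} = \dim {:W} ->
  exists2 g : 'Hom(V, W), (forall v, g v = 0 -> v = 0) & limg g = fullv.
Proof.
rewrite !dimvf => eq_d; pose g0 (v : V) : W := r2v (v2r v *m pid_mx (dim V)).
have g0_lin: linear g0.
  by move=> a x y; rewrite /g0 linearP mulmxDl -scalemxAl linearP.
pose g0M := GRing.isLinear.Build F V W _ _ g0_lin.
pose g0L : {linear _ -> _} := HB.pack g0 g0M.
have g_inj v: linfun g0 v = 0 -> v = 0.
  rewrite (lfunE g0L) /= => /(canRL r2vK); rewrite linear0 => v_pid0.
  have le_d: (dim V <= dim W)%N by rewrite eq_d.
  have v0: v2r v = 0.
    rewrite -[v2r v]mulmx1 -pid_mx_1 -(pid_mx_id _ _ _ le_d).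
    by rewrite mulmxA v_pid0 mul0mx.
  by rewrite -[v]v2rK v0 linear0.
exists (linfun g0) => //; apply/eqP.
by rewrite -(dimv_leqif_eq (subvf _)) dim_inj_img // !dimvf eq_d.
Qed.

Lemma partitionable_iso (V W : vectType F) T :
  \dim {:V} = \dim {:W} -> partitionable V T -> partitionable W T.
Proof.
move=> /esym/linear_iso[g g_inj g_onto] [f f_block f_dim].
have g_nz w: w != 0 -> g w != 0 by apply: contra_neq => /g_inj.
exists (fun w => (g @^-1: f (g w))%VS) => [w nz_w|t].
  have [fgw f_eq] := f_block _ (g_nz w nz_w).
  split=> [|w' nz_w']; first by rewrite -memv_preim.
  by rewrite -memv_preim => /f_eq->; rewrite ?g_nz.
have dim_pre X: \dim (g @^-1: X) = \dim X.
  by rewrite -(dim_inj_img _ g_inj) lpreimK // g_onto subvf.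
rewrite f_dim; split=> [] [v nz_v <-]; last by exists (g v); rewrite ?g_nz ?dim_pre.
have /memv_imgP[w _ def_v]: v \in limg g by rewrite g_onto memvf.
exists w; last by rewrite dim_pre -def_v.
by apply: contra_neq nz_v => w0; rewrite def_v w0 linear0.
Qed.

End BlockMaps.

Lemma T_partition_of_partitionable (F : finFieldType) n (T : {fset nat}) :
    (0 < n)%N -> partitionable 'rV[F]_n (fun t => t \in T) ->
  exists P : {fset {vspace 'rV[F]_n}}, T_partition T P.
Proof.
move=> n_gt0 [f f_block f_dim].
pose P : {fset {vspace 'rV[F]_n}} := [fset f v | v in [pred v | v != 0%R]].
have PP U: reflect (exists2 v, v != 0%R & U = f v) (U \in P).
  by apply: (iffP (imfsetP _ _ _ _)) => -[v nz_v ->]; exists v.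
exists P; split; [split|].
- move=> _ /PP[v nz_v ->]; have [fv_v _] := f_block v nz_v.
  by apply: contraNneq nz_v => fv0; rewrite fv0 memv0 in fv_v.
(* The zero vector has to lie in some component, hence a nonzero vector e. *)
- pose e : 'rV[F]_n := const_mx 1%R.
  have nz_e: e != 0%R.
    by apply/eqP=> /rowP/(_ (Ordinal n_gt0))/eqP; rewrite !mxE oner_eq0.
  move=> v; have [->|nz_v] := eqVneq v 0%R; last first.
    by exists (f v); [apply/PP; exists v | have [] := f_block v].
  by exists (f e); [apply/PP; exists e | rewrite mem0v].
- move=> _ _ /PP[v nz_v ->] /PP[w nz_w ->] neq_f.
  apply/eqP; rewrite -subv0; apply/subvP=> x; rewrite memv_cap memv0.
  case/andP=> fv_x fw_x; apply: contraNT neq_f => nz_x.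
  have [_ /(_ x nz_x fv_x) <-] := f_block v nz_v.
  by have [_ /(_ x nz_x fw_x) <-] := f_block w nz_w.
apply/fsetP=> t; apply/idP/(imfsetP _ _ _ _).
  move=> /f_dim[v nz_v <-].
  by exists (f v) => //; apply/PP; exists v.
by move=> [_ /= /PP[v nz_v ->] ->]; apply/f_dim; exists v.
Qed.

(** * Raising the dimension of the space *)

Section Extend.
Local Open Scope ring_scope.
Variables (F : finFieldType) (T : pred nat) (d m : nat).

(** Let K be the extension of degree m and B an F-subspace of K of dimension d.
    In K * B the vectors (u, b) with b != 0 are partitioned by the graphs of the
    multiplications b |-> c * b with c in K, because c = u / b is determined by
    the vector.  The remaining vectors form a copy of K, where the given
    partition is used. *)
Lemma partitionable_add : T d -> (0 < d <= m)%N ->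
  partitionable 'rV[F]_m T -> partitionable 'rV[F]_(m + d) T.
Proof.
move=> Td /andP[d_gt0 le_dm] partM.
have [K [_ [dimK _]]] := cyclic_extension F (leq_trans d_gt0 le_dm).
have [f0 f0_block f0_dim] :=
  partitionable_iso (etrans (dim_rV _ m) (esym dimK)) partM.
pose B := flag K d.
have dimB : \dim B = d by rewrite dim_flag // dimK.
pose vl : 'Hom(subvs_of B, K) := linfun vsval.
have vlE b : vl b = val b by rewrite lfunE.
pose V : vectType F := (K * subvs_of B)%type.
apply: (@partitionable_iso _ V).
  by rewrite dim_rV dim_pair dimK [X in (_ + X)%N]dimvf [dim _]/=; congr (_ + _)%N.
pose gr (c : K) : 'Hom(subvs_of B, V) := lfun_pair (amull c \o vl)%VF \1%VF.
have grE c b : gr c b = (c * val b, b).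
  by rewrite lfun_pairE comp_lfunE vlE !lfunE.
pose inK : 'Hom(K, V) := lfun_pair \1%VF 0.
have inKE u : inK u = (u, 0) by rewrite lfun_pairE lfunE zero_lfunE.
pose f (v : V) :=
  if v.2 == 0 then (inK @: f0 v.1)%VS else limg (gr (v.1 / val v.2)).
have val_eq0 (b : subvs_of B) : (val b == 0) = (b == 0) by [].
have f_in u : f (u, 0) = (inK @: f0 u)%VS by rewrite /f eqxx.
have f_gr c b : b != 0 -> f (c * val b, b) = limg (gr c).
  by move=> nz_b; rewrite /f /= (negPf nz_b) mulfK ?val_eq0.
have f_cases (v : V) : v != 0 -> (exists2 u, u != 0 & v = (u, 0)) \/
  (exists c, exists2 b : subvs_of B, b != 0 & v = (c * val b, b)).
  case: v => u b nz_v; have [b0|nz_b] := eqVneq b 0.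
    left; exists u; last by rewrite b0.
    by apply: contraNneq nz_v => u0; rewrite u0 b0.
  by right; exists (u / val b), b; rewrite // divfK ?val_eq0.
have dim_in U : \dim (inK @: U) = \dim U.
  by apply: dim_inj_img => u; rewrite inKE => -[].
have dim_gr c : \dim (limg (gr c)) = d.
  by rewrite dim_inj_img => [|b]; [rewrite dimvf | rewrite grE => -[]].
exists f => [v /f_cases[[u nz_u ->]|[c [b nz_b ->]]]|t].
- have [fu_u fu_eq] := f0_block u nz_u; rewrite f_in -inKE memv_img //.
  split=> // w nz_w /memv_imgP[u' fu_u' def_w]; rewrite def_w inKE f_in fu_eq //.
  by apply: contraNneq nz_w => u'0; rewrite def_w u'0 linear0.
- rewrite f_gr // -grE memv_img ?memvf //; split=> // w nz_w /memv_imgP[b' _ def_w].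
  rewrite def_w grE f_gr //; apply: contraNneq nz_w => b'0.
  by rewrite def_w b'0 linear0.
rewrite f0_dim; split=> [[u nz_u <-]|[v /f_cases[[u nz_u ->]|[c [b nz_b ->]]] <-]].
- exists (u, 0); last by rewrite f_in dim_in.
  by apply: contra_neq nz_u => -[].
- by exists u; rewrite // f_in dim_in.
by apply/f0_dim; rewrite f_gr // dim_gr.
Qed.

End Extend.

(** * Tiling the double of a field *)

Section Tiling.
Local Open Scope ring_scope.
Variables (F : finFieldType) (T : pred nat) (t1 N : nat).
Hypotheses (Tt1 : T t1) (TN : T N) (t1_min : forall t, T t -> (t1 <= t)%N)
  (TleN : forall t, T t -> (t <= N)%N) (t1_gt0 : (0 < t1)%N).
Variables (K : fieldExtType F) (phi : 'AEnd(K)).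
Hypotheses (dimK : \dim {:K} = N) (phi_fix : forall x, phi x = x -> x \in 1%VS).

Definition level x := find (fun j => x \in flag K j) (iota 0 N.+1).

Lemma flagN : flag K N = fullv.
Proof. by rewrite -dimK flagT. Qed.

Lemma mem_flag x j : (j <= N)%N -> (x \in flag K j) = (level x <= j)%N.
Proof.
move=> le_jN; have has_x: has (fun i => x \in flag K i) (iota 0 N.+1).
  by apply/hasP; exists N; rewrite ?flagN ?memvf // mem_iota /= ltnSn.
have le_xN : (level x < N.+1)%N by rewrite has_find size_iota in has_x.
apply/idP/idP=> [Ux | ].
  rewrite leqNgt; apply/negP=> /(before_find 0).
  by rewrite nth_iota // Ux.
move/(flagS K)/subvP; apply; have := nth_find 0 has_x.
by rewrite -/(level x) nth_iota.
Qed.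

Lemma level_max x : (level x <= N)%N.
Proof. by rewrite -mem_flag // flagN memvf. Qed.

Lemma levelZ k x : k != 0 -> level (k *: x) = level x.
Proof. by move=> nz_k; apply: eq_find => j; rewrite rpredZeq (negPf nz_k). Qed.

Local Notation V := (K * K)%type.
Local Notation r := (row_size Tt1).
Local Notation c := (col_size TN).

(** [row_map a] and [col_map x (phi x)] send x and a, respectively, to the
    vector (a x, a (phi x)) of the rectangle; [col_map u w] parametrises the
    K-line of an arbitrary vector (u, w). *)
Definition row_map (a : K) : 'Hom(K, V) :=
  lfun_pair (amull a) (amull a \o phi)%VF.
Definition col_map (u w : K) : 'Hom(K, V) := lfun_pair (amulr u) (amulr w).

Lemma row_mapE a x : row_map a x = (a * x, a * phi x).
Proof. by rewrite lfun_pairE comp_lfunE !lfunE. Qed.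

Lemma col_mapE u w z : col_map u w z = (z * u, z * w).
Proof. by rewrite lfun_pairE !lfunE. Qed.

(** The solutions x of w / u = phi x / x.  This depends on the slope w / u only,
    and it is F x if (u, w) = (a x, a (phi x)); picking a vector of it
    therefore chooses the same x for all vectors on a K-line. *)
Definition fiber (u w : K) : {vspace K} := lker (amull w - (amull u \o phi))%VF.

Lemma mem_fiber u w x : (x \in fiber u w) = (w * x == u * phi x).
Proof. by rewrite memv_ker add_lfunE opp_lfunE comp_lfunE !lfunE subr_eq0. Qed.

Lemma fiber_point a x :
  a != 0 -> x != 0 -> fiber (a * x) (a * phi x) = <[x]>%VS.
Proof.
move=> nz_a nz_x; apply/vspaceP=> y.
rewrite mem_fiber -!mulrA (inj_eq (mulfI nz_a)).
apply/eqP/vlineP=> [phi_y|[k ->]]; last first.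
  by rewrite linearZ -scalerAr -scalerAr mulrC.
have /phi_fix/vlineP[k def_k]: phi (y / x) = y / x.
  rewrite rmorphM fmorphV /=; apply: (canLR (mulfK _)); first by rewrite fmorph_eq0.
  by rewrite mulrAC [y * _]mulrC phi_y mulrAC mulfV // mul1r.
by exists k; rewrite -[y](divfK nz_x) def_k -scalerAl mul1r.
Qed.

(** The component of v: the whole K-line if its slope is not of the form
    phi x / x, which includes both coordinate axes, and otherwise the row tile
    or the column tile through the point (a, x) that represents v. *)
Definition block (v : V) : {vspace V} :=
  let x := vpick (fiber v.1 v.2) in let a := v.1 / x in
  if x == 0 then limg (col_map v.1 v.2)
  else if (level x <= r (level a))%N then (row_map a @: flag K (r (level a)))%VS
  else (col_map x (phi x) @: flag K (c (level x)))%VS.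

(** Replacing (a, x) by (a / k, k x) with k in F changes the parametrisation of
    a tile by a scalar of F only, so the tile does not depend on this choice. *)
Lemma img_scale (g h : 'Hom(K, V)) (U : {vspace K}) (k : F) :
  k != 0 -> (forall x, g x = h (k *: x)) -> (g @: U)%VS = (h @: U)%VS.
Proof.
move=> nz_k ghE; apply/vspaceP=> v; apply/memv_imgP/memv_imgP=> -[x Ux ->].
  by exists (k *: x); rewrite ?memvZ.
by exists (k^-1 *: x); rewrite ?memvZ // ghE scalerA divff // scale1r.
Qed.

Lemma block_point a x : a != 0 -> x != 0 ->
  block (a * x, a * phi x) =
    (if (level x <= r (level a))%N then row_map a @: flag K (r (level a))
     else col_map x (phi x) @: flag K (c (level x)))%VS.
Proof.
move=> nz_a nz_x; rewrite /block /= fiber_point //.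
have /vlineP[k def_y]: vpick <[x]>%VS \in <[x]>%VS := memv_pick _.
have: vpick <[x]>%VS != 0 by rewrite vpick0 -dimv_eq0 dim_vline nz_x.
rewrite {}def_y => nz_kx; rewrite (negPf nz_kx).
have nz_k: k != 0 by apply: contraNneq nz_kx => ->; rewrite scale0r.
have ->: a * x / (k *: x) = k^-1 *: a.
  apply: (canLR (mulfK nz_kx)).
  by rewrite -scalerAl -scalerAr scalerA mulVf // scale1r.
rewrite !levelZ ?invr_eq0 //; case: ifP => _.
  apply: (@img_scale _ _ _ k^-1) => [|y]; rewrite ?invr_eq0 // !row_mapE.
  by rewrite linearZ -!scalerAl -!scalerAr.
apply: (@img_scale _ _ _ k) => [|y] //; rewrite !col_mapE.
by rewrite linearZ -!scalerAl -!scalerAr.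
Qed.

Lemma pair_cases (v : V) : v != 0 ->
    (exists a, exists2 x, a != 0 /\ x != 0 & v = (a * x, a * phi x)) \/
  fiber v.1 v.2 = 0%VS.
Proof.
case: v => u w /= nz_v; have [->|] := eqVneq (fiber u w) 0%VS; first by right.
rewrite -vpick0; set x := vpick _ => nz_x; left.
have: x \in fiber u w := memv_pick _; rewrite mem_fiber => /eqP def_wx.
have def_w: w = u / x * phi x by rewrite mulrAC -def_wx mulfK.
exists (u / x), x; last by rewrite divfK -?def_w.
split=> //; apply: contraNneq nz_v => ux0.
by rewrite def_w ux0 mul0r -[u](divfK nz_x) ux0 mul0r.
Qed.

Lemma block_line (u w : K) :
  fiber u w = 0%VS -> block (u, w) = limg (col_map u w).
Proof. by rewrite /block /= => ->; rewrite vpick0 eqxx. Qed.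

Lemma block_is_block_map : block_map block.
Proof.
move=> v nz_v; have [[a [x [nz_a nz_x] ->]]|] := pair_cases nz_v; last first.
  case: v nz_v => u w /= nz_uw fib0; rewrite block_line //; split.
    by apply/memv_imgP; exists 1; rewrite ?memvf // col_mapE !mul1r.
  move=> w' nz_w' /memv_imgP[z _ def_w']; rewrite def_w' col_mapE in nz_w' *.
  have nz_z: z != 0 by apply: contraNneq nz_w' => ->; rewrite !mul0r.
  rewrite block_line; last first.
    rewrite -fib0; apply/vspaceP=> y.
    by rewrite !mem_fiber -!mulrA (inj_eq (mulfI nz_z)).
  apply/vspaceP=> y; apply/memv_imgP/memv_imgP=> -[s _ ->].
    by exists (s * z); rewrite ?memvf // !col_mapE !mulrA.
  by exists (s / z); rewrite ?memvf // !col_mapE !mulrA divfK.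
have le_xN := level_max x.
rewrite block_point //; case: ifPn => [le_x|]; last rewrite -ltnNge => lt_x.
  split=> [|w nz_w /memv_imgP[y]].
    by rewrite -row_mapE memv_img // mem_flag // TleN ?row_size_in.
  rewrite mem_flag ?TleN ?row_size_in // => le_y def_w.
  rewrite def_w row_mapE block_point ?le_y //.
  by apply: contraNneq nz_w => y0; rewrite def_w y0 linear0.
(* Row tiles have size at least t1, so column tiles start above level t1. *)
have lt_t1x : (t1 < level x)%N.
  by apply: leq_ltn_trans lt_x; apply/t1_min/row_size_in.
have le_cN: (c (level x) <= N)%N by rewrite TleN ?col_size_in.
split=> [|w nz_w /memv_imgP[b]].
  by rewrite -col_mapE memv_img // mem_flag // -(row_size_lt_col_size Tt1 TN).
rewrite mem_flag // => le_b def_w; rewrite def_w col_mapE block_point //.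
  by rewrite leqNgt (row_size_lt_col_size Tt1 TN) // le_b.
by apply: contraNneq nz_w => b0; rewrite def_w b0 linear0.
Qed.

Lemma dim_row_map (a : K) U : a != 0 -> \dim (row_map a @: U) = \dim U.
Proof.
move=> nz_a; apply: dim_inj_img => x; rewrite row_mapE => -[/eqP].
by rewrite mulf_eq0 (negPf nz_a) => /eqP.
Qed.

Lemma dim_col_map (u w : K) U : (u, w) != 0 -> \dim (col_map u w @: U) = \dim U.
Proof.
move=> nz_uw; apply: dim_inj_img => z; rewrite col_mapE => -[zu0 zw0].
apply: contraNeq nz_uw => nz_z; move/eqP: zu0; move/eqP: zw0.
by rewrite !mulf_eq0 (negPf nz_z) /= => /eqP-> /eqP->.
Qed.

(** Size N occurs as the line through (1, 0), whose slope 0 is not of the form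
    phi x / x.  A size t < N occurs as the row tile of a vector a of level
    t + 1; a vector x of level 1 gives a point of that tile. *)
Lemma partitionable_double : partitionable V T.
Proof.
exists block; first exact: block_is_block_map.
have pair_nz (u w : K) : u != 0 -> (u, w) != 0 by apply: contra_neq => -[].
move=> t; split=> [Tt|[v nz_v <-]].
  have N_gt0: (0 < N)%N := leq_trans t1_gt0 (t1_min TN).
  have nz10 : (1 : K, 0 : K) != 0 by rewrite pair_nz ?oner_eq0.
  have := TleN Tt; rewrite leq_eqVlt => /predU1P[->|lt_tN].
    exists (1, 0) => //; rewrite block_line ?dim_col_map //.
    by apply/vspaceP=> x; rewrite mem_fiber mul0r mul1r memv0 eq_sym fmorph_eq0.
  have flag_pick j : (j < N)%N -> exists2 a, a != 0 & level a = j.+1.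
    move=> lt_jN; have /subvPn[a Ua U'a]: ~~ (flag K j.+1 <= flag K j)%VS.
      by apply/negP=> /dimvS; rewrite !dim_flag ?dimK ?ltnn // ltnW.
    exists a; first by apply: contraNneq U'a => ->; rewrite mem0v.
    by apply/eqP; rewrite eqn_leq ltnNge -!mem_flag // ?Ua // ltnW.
  have [a nz_a level_a] := flag_pick t lt_tN.
  have [x nz_x level_x] := flag_pick 0%N N_gt0.
  exists (a * x, a * phi x); first by rewrite pair_nz ?mulf_neq0.
  have t_gt0 : (0 < t)%N := leq_trans t1_gt0 (t1_min Tt).
  rewrite block_point // level_a level_x row_sizeS // t_gt0.
  by rewrite dim_row_map // dim_flag ?dimK // ltnW.
have [[a [x [nz_a nz_x] ->]]|] := pair_cases nz_v; last first.
  by case: v nz_v => u w nz_uw /= /block_line->; rewrite dim_col_map // dimK.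
rewrite block_point //; case: ifP => _.
  by rewrite dim_row_map // dim_flag ?dimK ?TleN ?row_size_in.
by rewrite dim_col_map ?pair_nz // dim_flag ?dimK ?TleN ?col_size_in.
Qed.

End Tiling.

(** * Assembling the partition *)

(** The extension step needs d to be at most the current dimension; it starts
    from 2N, and d <= N. *)
Lemma partitionable_of_dvd (F : finFieldType) (T : pred nat)
    (t1 N n d : nat) :
    T t1 -> T N -> (forall t, T t -> t1 <= t <= N) -> 0 < t1 ->
    T d -> 2 * N <= n -> d %| n -> d %| 2 * N ->
  partitionable 'rV[F]_n T.
Proof.
move=> Tt1 TN T_bound t1_gt0 Td le_2Nn d_n d_2N.
have t1_min t : T t -> t1 <= t by case/T_bound/andP.
have TleN t : T t -> t <= N by case/T_bound/andP.
have d_gt0 : 0 < d := leq_trans t1_gt0 (t1_min d Td).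
have [K [phi [dimK phi_fix]]] :=
  cyclic_extension F (leq_trans t1_gt0 (t1_min N TN)).
have part2N : partitionable 'rV[F]_(2 * N) T.
  have := partitionable_double Tt1 TN t1_min TleN t1_gt0 dimK phi_fix.
  apply: partitionable_iso.
  by rewrite dim_pair dimK dim_rV mul2n addnn.
have /dvdnP[j def_j]: d %| n - 2 * N by rewrite dvdn_sub.
rewrite -(subnKC le_2Nn) {}def_j; elim: j => [|j IHj]; first by rewrite addn0.
rewrite mulSn addnCA addnC; apply: partitionable_add => //; rewrite d_gt0.
exact: leq_trans (TleN d Td) (leq_trans (leq_pmull N (isT : 0 < 2)) (leq_addr _ _)).
Qed.

Theorem theorem4p2 (q : nat) (hq : prime_power q)
    (F : finFieldType) (hF : #|F| = q)
    (k : nat) (hk : 1 <= k) (ns : seq nat) (hns : size ns = k)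
    (hsorted : sorted ltn ns)
    (T : {fset nat}) (hT : T = [fset t in ns])
    (hpos : forall t, t \in T -> 0 < t)
    (nk : nat) (hnk : nk = last 0 ns)
    (n : nat) (hn : 2 * nk <= n)
    (hdvd : exists2 t, t \in T & t %| gcdn n (2 * nk)) :
  exists P : {fset {vspace 'rV[F]_n}}, T_partition T P.
Proof.
have Tns t: (t \in T) = (t \in ns) by rewrite hT in_fset.
case: ns hk hns hsorted hnk {hT} Tns => [|t1 s] hk hns /= sorted_s def_N Tns.
  by rewrite -hns in hk.
have TN: nk \in T by rewrite Tns def_N mem_last.
have Tt1: t1 \in T by rewrite Tns mem_head.
have T_bound t: t \in T -> t1 <= t <= nk.
  rewrite Tns def_N => ns_t; apply/andP; split.
    move: ns_t; rewrite inE => /predU1P[-> //|s_t]; apply: ltnW.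
    exact: (allP (order_path_min ltn_trans sorted_s)).
  have sorted_le: sorted leq (t1 :: s).
    by apply: sub_path sorted_s => x y; apply: ltnW.
  have /(nthP 0)[i lt_i <-] := ns_t.
  rewrite [X in _ <= X](_ : _ = nth 0 (t1 :: s) (size s)); last first.
    by rewrite -[size s]/(size (t1 :: s)).-1 nth_last.
  by apply: (sorted_leq_nth leq_trans leqnn) sorted_le _ _ _ _ _; rewrite ?inE.
have t1_gt0: 0 < t1 := hpos t1 Tt1.
have n_gt0: 0 < n by rewrite (leq_trans _ hn) // muln_gt0 (hpos nk TN).
have [d Td] := hdvd; rewrite dvdn_gcd => /andP[d_n d_2N].
apply: T_partition_of_partitionable => //.
exact: (@partitionable_of_dvd F (fun t => t \in T) t1 nk n d).
Qed.
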